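(* Let $n_1\in\mathbb{Z}_{\ge0}$, $n_2\in\mathbb{Z}_{\ge1}$, let $\ell$ be a prime number, and let $t=\ell^{n_1+1}+\ell^{n_1}$. For the bouquet $X_t$ consisting of $t$ loops there is a vector $\alpha\in\mathbb{Z}_\ell^t\setminus(\ell\mathbb{Z}_\ell)^t$ (depending on both $n_1$ and $n_2$) such that the associated Iwasawa invariants satisfy $$\mu_\ell(X_t,\alpha)=n_1,\qquad \lambda_\ell(X_t,\alpha)=2\ell^{n_2}-1.$$
   Context: For $b\in\mathbb{Z}_\ell$ put $\binom{b}{n}=\frac{b(b-1)\cdots(b-n+1)}{n!}\in\mathbb{Z}_\ell$ and $(1+T)^b=\sum_{n\ge0}\binom{b}{n}T^n\in\mathbb{Z}_\ell[[T]]$. The bouquet $X_t$ is the multigraph with one vertex and $t$ undirected loops; a vector $\alpha=(\alpha_1,\dots,\alpha_t)\in\mathbb{Z}_\ell^t$ assigns the voltage $\alpha_j$ to the $j$-th loop. It is admissible if $\alpha\in\mathbb{Z}_\ell^t\setminus(\ell\mathbb{Z}_\ell)^t$. The characteristic series is $$f(T)=f_{X_t,\alpha}(T)=\sum_{j=1}^t\big(2-(1+T)^{\alpha_j}-(1+T)^{-\alpha_j}\big)\in\mathbb{Z}_\ell[[T]].$$ For admissible $\alpha$ it is nonzero, and it has zero constant term. By Weierstrass preparation write $f(T)=\ell^{\mu}g(T)u(T)$ with $\mu\in\mathbb{Z}_{\ge0}$, $g$ a distinguished polynomial (monic, all non-leading coefficients divisible by $\ell$) and $u\in\mathbb{Z}_\ell[[T]]^\times$.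 Then $\mu_\ell(X_t,\alpha):=\mu$ and $\lambda_\ell(X_t,\alpha):=\deg g-1$ (note the shift by $-1$). *)

(* Defs.v *)
From HB Require Import structures.
From mathcomp Require Import all_boot all_order all_algebra.
From mathcomp Require Import boolp classical_sets.
Set Implicit Arguments.
Unset Strict Implicit.
Unset Printing Implicit Defensive.
Import Order.TTheory GRing.Theory Num.Theory.
Local Open Scope ring_scope.

Lemma modz_dvdm (m d e : int) : (d %| e)%Z ->
  ((m %% e)%Z %% d)%Z = (m %% d)%Z.
Proof.
move=> de; apply/eqP; rewrite eqz_mod_dvd (dvdz_trans de) // -eqz_mod_dvd.
by rewrite modz_mod.
Qed.

(* The ring Z_l of l-adic integers, as the inverse limit of the Z/l^n: an
   element is the sequence of its canonical residues 0 <= x_n < l^n. *)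
Section PadicIntegers.
Variables (l : nat) (l_pr : prime l).

Record padic_int (pr : prime l) := PadicInt {
  residue : nat -> int;
  residueP : forall n, residue n = (residue n.+1 %% (l ^ n)%N)%Z }.

Local Notation Zl := (padic_int l_pr).
Local Notation "''q_' n" := (Posz (expn l n)) (at level 8, n at level 2).

HB.instance Definition _ := gen_eqMixin Zl.
HB.instance Definition _ := gen_choiceMixin Zl.

Lemma padic_eqP (x y : Zl) : (forall n, residue x n = residue y n) -> x = y.
Proof.
case: x y => [x xP] [y yP] /= /funext exy; case: _ / exy in yP *.
by rewrite (Prop_irrelevance xP yP).
Qed.

Lemma residue_mod (x : Zl) n : (residue x n %% 'q_n)%Z = residue x n.
Proof. by rewrite residueP modz_mod. Qed.

Lemma residue_ge0 (x : Zl) n : 0 <= residue x n.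
Proof.
by rewrite -residue_mod modz_ge0 // eqz_nat -lt0n expn_gt0 prime_gt0.
Qed.

Lemma dvd_q m n : (m <= n)%N -> ('q_m %| 'q_n)%Z.
Proof. by move=> le_mn; rewrite dvdzE !absz_nat dvdn_exp2l. Qed.

Lemma residue_le (x : Zl) m n :
  (m <= n)%N -> residue x m = (residue x n %% 'q_m)%Z.
Proof.
move=> /subnKC <-; elim: (n - m)%N => [|k IHk].
  by rewrite addn0 residue_mod.
rewrite {}IHk residueP addnS modz_dvdm //.
exact/dvd_q/leq_addr.
Qed.

Definition coherent (s : nat -> int) :=
  forall n, (s n.+1 = s n %[mod 'q_n])%Z.

Lemma padic_subproof (s : nat -> int) (sP : coherent s) n :
  (s n %% 'q_n)%Z = ((s n.+1 %% 'q_n.+1)%Z %% 'q_n)%Z.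
Proof. by rewrite modz_dvdm ?dvd_q. Qed.

Definition padic_of (s : nat -> int) (sP : coherent s) : Zl :=
  PadicInt l_pr (padic_subproof sP).

Lemma residue_coherent (x : Zl) : coherent (residue x).
Proof. by move=> n; rewrite -residueP residue_mod. Qed.

Lemma coherent_cst (a : int) : coherent (fun=> a). Proof. by []. Qed.

Lemma coherentD s t : coherent s -> coherent t -> coherent (fun n => s n + t n).
Proof. by move=> sP tP n; rewrite -modzDm sP tP modzDm. Qed.

Lemma coherentN s : coherent s -> coherent (fun n => - s n).
Proof. by move=> sP n; rewrite -modzNm sP modzNm. Qed.

Lemma coherentM s t : coherent s -> coherent t -> coherent (fun n => s n * t n).
Proof. by move=> sP tP n; rewrite -modzMm sP tP modzMm. Qed.

Definition padic_zero : Zl := padic_of (coherent_cst 0).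
Definition padic_one : Zl := padic_of (coherent_cst 1).
Definition padic_add (x y : Zl) : Zl :=
  padic_of (coherentD (residue_coherent x) (residue_coherent y)).
Definition padic_opp (x : Zl) : Zl :=
  padic_of (coherentN (residue_coherent x)).
Definition padic_mul (x y : Zl) : Zl :=
  padic_of (coherentM (residue_coherent x) (residue_coherent y)).

Lemma padic_addA : associative padic_add.
Proof. by move=> x y z; apply: padic_eqP => n /=; rewrite modzDml modzDmr addrA. Qed.
Lemma padic_addC : commutative padic_add.
Proof. by move=> x y; apply: padic_eqP => n /=; rewrite addrC. Qed.
Lemma padic_add0 : left_id padic_zero padic_add.
Proof. by move=> x; apply: padic_eqP => n /=; rewrite modzDml add0r residue_mod. Qed.
Lemma padic_addN : left_inverse padic_zero padic_opp padic_add.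
Proof. by move=> x; apply: padic_eqP => n /=; rewrite modzDml addNr. Qed.

HB.instance Definition _ := GRing.isZmodule.Build Zl
  padic_addA padic_addC padic_add0 padic_addN.

Lemma padic_mulA : associative padic_mul.
Proof. by move=> x y z; apply: padic_eqP => n /=; rewrite modzMml modzMmr mulrA. Qed.
Lemma padic_mulC : commutative padic_mul.
Proof. by move=> x y; apply: padic_eqP => n /=; rewrite mulrC. Qed.
Lemma padic_mul1 : left_id padic_one padic_mul.
Proof. by move=> x; apply: padic_eqP => n /=; rewrite modzMml mul1r residue_mod. Qed.
Lemma padic_mulD : left_distributive padic_mul padic_add.
Proof.
by move=> x y z; apply: padic_eqP => n /=; rewrite modzMml modzDm mulrDl.
Qed.
Lemma padic_oner_neq0 : padic_one != 0.
Proof.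
apply/eqP => /(congr1 (fun x => residue x 1)) /=.
by rewrite expn1 mod0z modz_small // ltz_nat prime_gt1.
Qed.

HB.instance Definition _ := GRing.Zmodule_isComNzRing.Build Zl
  padic_mulA padic_mulC padic_mul1 padic_mulD padic_oner_neq0.

Lemma residueD (x y : Zl) n :
  residue (x + y) n = ((residue x n + residue y n) %% 'q_n)%Z.
Proof. by []. Qed.

Lemma residueN (x : Zl) n : residue (- x) n = ((- residue x n) %% 'q_n)%Z.
Proof. by []. Qed.

Lemma residueM (x y : Zl) n :
  residue (x * y) n = ((residue x n * residue y n) %% 'q_n)%Z.
Proof. by []. Qed.

Lemma residue_nat (m n : nat) :
  residue (m%:R : Zl) n = (m%:Z %% 'q_n)%Z.
Proof.
elim: m => [|m IHm]; first by [].
by rewrite -addn1 natrD residueD IHm modzDm PoszD.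
Qed.

Lemma dvdz_cancel (m : nat) (d : int) k : (0 < m)%N ->
  ('q_(k + logn l m) %| m%:Z * d)%Z -> ('q_k %| d)%Z.
Proof.
move=> m_gt0; rewrite !dvdzE !abszM !absz_nat.
have [m' co_lm' def_m] := pfactor_coprime l_pr m_gt0.
rewrite expnD [X in (_ %| X * _)%N]def_m mulnAC dvdn_pmul2r.
  by rewrite Gauss_dvdr // coprimeXl.
by rewrite expn_gt0 prime_gt0.
Qed.

Lemma padic_natr_lreg (m : nat) : (0 < m)%N -> GRing.lreg (m%:R : Zl).
Proof.
move=> m_gt0 x y /(congr1 (fun z => residue z _)) eq_mxy.
apply: padic_eqP => k.
have le_k : (k <= k + logn l m)%N by apply: leq_addr.
rewrite !(residue_le _ le_k); apply/eqP; rewrite eqz_mod_dvd.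
apply: (dvdz_cancel m_gt0); rewrite mulrBr -eqz_mod_dvd; apply/eqP.
by move: (eq_mxy (k + logn l m)%N); rewrite !residueM residue_nat !modzMml.
Qed.

Lemma ffactE_int (r n : nat) :
  \prod_(i < n) (r%:Z - i%:Z) = (r ^_ n)%:Z.
Proof.
elim: n => [|n IHn]; first by rewrite big_ord0.
rewrite big_ord_recr /= IHn ffactnSr; have [le_nr|lt_rn] := leqP n r.
  by rewrite subzn.
by rewrite ffact_small // mul0r.
Qed.

Lemma ffact_mod (x : Zl) n N :
  residue (\prod_(i < n) (x - i%:R)) N
    = ((`|residue x N| ^_ n)%N%:Z %% 'q_N)%Z.
Proof.
rewrite -ffactE_int gez0_abs ?residue_ge0 //; elim: n => [|n IHn].
  by rewrite !big_ord0.
rewrite !big_ord_recr residueM IHn residueD residueN residue_nat.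
by rewrite modzMm -modzMmr modzNm modzDmr modzMmr.
Qed.

Lemma padic_binom_exists (b : Zl) (n : nat) :
  exists c : Zl, n`!%:R * c = \prod_(i < n) (b - i%:R).
Proof.
pose v := logn l n`!; pose r k := `|residue b (k + v)|%N.
have res_ge0 k : (r k)%:Z = residue b (k + v).
  exact/gez0_abs/residue_ge0.
have binE m : n`!%:Z * 'C(m, n)%:Z = (m ^_ n)%:Z.
  by rewrite -PoszM mulnC bin_ffact.
have cP : coherent (fun k => 'C(r k, n)%:Z).
  move=> k; apply/eqP; rewrite eqz_mod_dvd.
  apply: (dvdz_cancel (fact_gt0 n)); rewrite mulrBr !binE -eqz_mod_dvd.
  have le_q : (k + v <= k.+1 + v)%N by rewrite leq_add2r.
  rewrite -ffact_mod (residue_le _ le_q) ffact_mod modz_dvdm ?dvd_q //.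
exists (padic_of cP); apply: padic_eqP => k.
have le_q : (k <= k + v)%N by apply: leq_addr.
rewrite residueM residue_nat modzMm binE [RHS](residue_le _ le_q) ffact_mod.
by rewrite modz_dvdm ?dvd_q.
Qed.

(* binom(b, n) = b (b - 1) ... (b - n + 1) / n!, where the quotient in Z_l
   exists and is unique, see padic_binomE and padic_binom_unique. *)
Definition padic_binom (b : Zl) (n : nat) : Zl :=
  xget 0 [set c : Zl | n`!%:R * c = \prod_(i < n) (b - i%:R)].

Lemma padic_binomE (b : Zl) (n : nat) :
  n`!%:R * padic_binom b n = \prod_(i < n) (b - i%:R).
Proof.
by rewrite /padic_binom; case: xgetP => // noc; have [c /noc] := padic_binom_exists b n.
Qed.

Lemma padic_binom_unique (b c : Zl) (n : nat) :
  n`!%:R * c = \prod_(i < n) (b - i%:R) -> c = padic_binom b n.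
Proof. by rewrite -padic_binomE => /(padic_natr_lreg (fact_gt0 n)). Qed.

Definition dvd_ell (x : Zl) : Prop := exists y : Zl, x = l%:R * y.

End PadicIntegers.

Record fps (R : Type) := FPS { coefs : nat -> R }.

Lemma fps_eqP (R : Type) (f g : fps R) :
  (forall n, coefs f n = coefs g n) -> f = g.
Proof. by case: f g => [f] [g] /= /funext ->. Qed.

HB.instance Definition _ (R : Type) := gen_eqMixin (fps R).
HB.instance Definition _ (R : Type) := gen_choiceMixin (fps R).

Section PowerSeries.
Variable R : comNzRingType.
Implicit Types f g h : fps R.

Definition fps_of_poly (p : {poly R}) : fps R := FPS (fun n => p`_n).

Definition fps_zero : fps R := FPS (fun=> 0).
Definition fps_add f g : fps R := FPS (fun n => coefs f n + coefs g n).
Definition fps_opp f : fps R := FPS (fun n => - coefs f n).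
Definition fps_one : fps R := FPS (fun n => (n == 0)%:R).
Definition fps_mul f g : fps R :=
  FPS (fun n => \sum_(i < n.+1) coefs f i * coefs g (n - i)).

Lemma fps_addA : associative fps_add.
Proof. by move=> f g h; apply: fps_eqP => n; apply: addrA. Qed.
Lemma fps_addC : commutative fps_add.
Proof. by move=> f g; apply: fps_eqP => n; apply: addrC. Qed.
Lemma fps_add0 : left_id fps_zero fps_add.
Proof. by move=> f; apply: fps_eqP => n; apply: add0r. Qed.
Lemma fps_addN : left_inverse fps_zero fps_opp fps_add.
Proof. by move=> f; apply: fps_eqP => n; apply: addNr. Qed.

HB.instance Definition _ := GRing.isZmodule.Build (fps R)
  fps_addA fps_addC fps_add0 fps_addN.

Let trunc n f : {poly R} := \poly_(i < n) coefs f i.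

Let truncM N n f g : (n < N)%N ->
  coefs (fps_mul f g) n = (trunc N f * trunc N g)`_n.
Proof.
move=> lt_nN; rewrite coefM; apply: eq_bigr => i _.
by rewrite !coef_poly (leq_ltn_trans (leq_ord i)) // (leq_ltn_trans (leq_subr _ _)).
Qed.

Lemma fps_mulA : associative fps_mul.
Proof.
move=> f g h; apply: fps_eqP => n.
transitivity (trunc n.+1 f * trunc n.+1 g * trunc n.+1 h)`_n.
  rewrite -mulrA coefM; apply: eq_bigr => i _.
  by rewrite -truncM ?ltnS ?leq_subr // coef_poly ltn_ord.
rewrite coefM; apply: eq_bigr => i _.
by rewrite -truncM // coef_poly ltnS leq_subr.
Qed.
Lemma fps_mulC : commutative fps_mul.
Proof.
by move=> f g; apply: fps_eqP => n; rewrite !(@truncM n.+1) // mulrC.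
Qed.
Lemma fps_mul1 : left_id fps_one fps_mul.
Proof.
move=> f; apply: fps_eqP => n /=; rewrite big_ord_recl /= subn0 mul1r.
by rewrite big1 ?addr0 // => i _; rewrite mul0r.
Qed.
Lemma fps_mulD : left_distributive fps_mul fps_add.
Proof.
move=> f g h; apply: fps_eqP => n /=; rewrite -big_split.
by apply: eq_bigr => i _; rewrite mulrDl.
Qed.
Lemma fps_oner_neq0 : fps_one != 0.
Proof.
by apply/eqP => /(congr1 (fun f => coefs f 0)) /eqP; rewrite /= oner_eq0.
Qed.

HB.instance Definition _ := GRing.Zmodule_isComNzRing.Build (fps R)
  fps_mulA fps_mulC fps_mul1 fps_mulD fps_oner_neq0.

Definition fps_unit : pred (fps R) := fun f => `[< exists g, g * f = 1 >].
Definition fps_inv f : fps R :=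
  if fps_unit f then xget 0 [set g | g * f = 1] else f.

Lemma fps_mulVf : {in fps_unit, left_inverse 1 fps_inv *%R}.
Proof.
move=> f f_unit; rewrite /fps_inv (f_unit : fps_unit f).
by case: xgetP => // nog; case/asboolP: f_unit => g /nog.
Qed.
Lemma fps_unitPl f g : g * f = 1 -> fps_unit f.
Proof. by move=> gf1; apply/asboolP; exists g. Qed.
Lemma fps_inv_out : {in [predC fps_unit], fps_inv =1 id}.
Proof. by move=> f f_nu; rewrite /fps_inv ifN. Qed.

HB.instance Definition _ := GRing.ComNzRing_hasMulInverse.Build (fps R)
  fps_mulVf fps_unitPl fps_inv_out.

End PowerSeries.

Section IwasawaInvariants.
Variables (l : nat) (l_pr : prime l).
Local Notation Zl := (padic_int l_pr).

(* (1 + T)^b *)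
Definition onepT_pow (b : Zl) : fps Zl := FPS (padic_binom b).

Definition admissible t (alpha : 'rV[Zl]_t) : Prop :=
  ~ (forall j, dvd_ell (alpha 0 j)).

(* The characteristic series f of the bouquet X_t of t loops, the j-th loop
   having voltage alpha_j. *)
Definition bouquet_series t (alpha : 'rV[Zl]_t) : fps Zl :=
  \sum_(j < t) (2 - onepT_pow (alpha 0 j) - onepT_pow (- alpha 0 j)).

Definition distinguished (g : {poly Zl}) : Prop :=
  g \is monic /\ forall i, (i < (size g).-1)%N -> dvd_ell g`_i.

Definition weierstrass_fact (f : fps Zl) (w : nat * {poly Zl} * fps Zl) : Prop :=
  let: (mu, g, u) := w in
  [/\ distinguished g, u \is a GRing.unit
    & f = l%:R ^+ mu * fps_of_poly g * u].

(* The Weierstrass factorization (mu, g, u) of f; it exists and is unique for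
   f != 0, and (0, 0, 0) is a dummy value when there is none. *)
Definition weierstrass (f : fps Zl) : nat * {poly Zl} * fps Zl :=
  xget (0%N, 0, 0) [set w | weierstrass_fact f w].

Definition mu_inv t (alpha : 'rV[Zl]_t) : nat :=
  (weierstrass (bouquet_series alpha)).1.1.

(* deg g - 1; the value is in int since the degree may be 0 a priori *)
Definition lambda_inv t (alpha : 'rV[Zl]_t) : int :=
  (size (weierstrass (bouquet_series alpha)).1.2).-1%:Z - 1.

End IwasawaInvariants.

(* Main.v *)
(** Take [l^(n1+1)] loops with voltage [1] and [l^n1] loops with voltage
    [q = l^n2].  Since [2 - B - B^-1 = - B^-1 (B - 1)^2], the characteristic
    series is [l^n1 * P * (- (1+T)^(-q))] for the explicit polynomial
    [P = ((1+T)^q - 1)^2 + l T^2 (1+T)^(q-1)], which is distinguished of degree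
    [2q] because [(1+T)^q - 1 = T^q] modulo [l] and [q + 1 < 2q].  The invariants
    can be read off any such factorization: modulo [l], a distinguished
    polynomial of degree [d] times a unit has order exactly [d]. *)
From HB Require Import structures.
Require Import Defs.
From mathcomp Require Import all_boot all_order all_algebra.
From mathcomp Require Import boolp classical_sets ring zify.
Import GRing.Theory.
Local Open Scope ring_scope.

(** * Binomial coefficients and degree bounds *)

Lemma prime_dvd_bin_exp (p n k : nat) : prime p ->
  (0 < k < p ^ n)%N -> (p %| 'C(p ^ n, k))%N.
Proof.
case: k => // k p_pr /andP[_]; apply: contraLR => p_ndvd.
rewrite -leqNgt dvdn_leq //.
have co_pC : coprime (p ^ n) 'C(p ^ n, k.+1) by rewrite coprimeXl // prime_coprime.
(* Since [(k+1) C(p^n, k+1) = p^n C(p^n - 1, k)], coprimality forces [p^n] to divide [k+1], which is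
   too small. *)
by rewrite -(Gauss_dvdl _ co_pC) -mul_bin_diag dvdn_mulr.
Qed.

Lemma coef_XD1_exp (R : comNzRingType) n k :
  (('X + 1 : {poly R}) ^+ n)`_k = 'C(n, k)%:R.
Proof.
have -> : ('X + 1 : {poly R}) ^+ n = \poly_(i < n.+1) 'C(n, i)%:R.
  rewrite addrC exprDn poly_def; apply: eq_bigr => i _.
  by rewrite expr1n mul1r -mulr_natl -scaler_nat mulr_algl.
by rewrite coef_poly ltnS; case: leqP => // /bin_small ->.
Qed.

Lemma size_natrM_leq (R : comNzRingType) n (p : {poly R}) :
  (size (n%:R * p)%R <= size p)%N.
Proof. by rewrite mulr_natl -scaler_nat size_scale_leq. Qed.

(** Bounds what remains of [P] after removing [X^(2q)] and dividing by [l] (case [a = 2], [c = l]).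
    The last summand has degree [q + 1], which is below [2q] because [q > 1]. *)
Lemma size_weierstrass_poly_tail (R : comNzRingType) (r : {poly R}) a c q :
    (1 < q)%N -> (size r <= q)%N ->
  (size (a%:R * ('X^q * r) + c%:R * r ^+ 2 + 'X^2 * (1 + 'X) ^+ q.-1)%R
    <= q + q)%N.
Proof.
move=> q_gt1 size_r.
apply: leq_trans (size_polyD _ _) _; rewrite geq_max; apply/andP; split.
  apply: leq_trans (size_polyD _ _) _; rewrite geq_max; apply/andP.
  split; apply: leq_trans (size_natrM_leq _ _ _) _.
    by apply: leq_trans (size_polyMleq _ _) _; rewrite size_polyXn; lia.
  by apply: leq_trans (size_poly_exp_leq _ _) _; lia.
rewrite [1 + 'X]addrC; apply: leq_trans (size_polyMleq _ _) _.
rewrite size_polyXn; have := size_poly_exp_leq ('X + 1 : {poly R}) q.-1.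
rewrite size_XaddC mul1n => size_XD1.
by apply: leq_trans (leq_add (leqnn 2) size_XD1) _; lia.
Qed.

(** * Polynomials as power series *)

Section FpsOfPoly.
Variable R : comNzRingType.

Lemma fps_of_poly_is_zmod_morphism : zmod_morphism (@fps_of_poly R).
Proof. by move=> p q; apply: fps_eqP => n /=; rewrite coefB. Qed.

Lemma fps_of_poly_is_monoid_morphism : monoid_morphism (@fps_of_poly R).
Proof.
split=> [|p q]; apply: fps_eqP => n /=; first by rewrite coef1.
by rewrite coefM.
Qed.

HB.instance Definition _ := GRing.isZmodMorphism.Build {poly R} (fps R)
  (@fps_of_poly R) fps_of_poly_is_zmod_morphism.
HB.instance Definition _ := GRing.isMonoidMorphism.Build {poly R} (fps R)
  (@fps_of_poly R) fps_of_poly_is_monoid_morphism.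

Lemma coefs_natrM (m n : nat) (f : fps R) :
  coefs (m%:R * f) n = m%:R * coefs f n.
Proof.
rewrite !mulr_natl; elim: m => [|m IHm] //.
by rewrite !mulrS /= IHm.
Qed.

End FpsOfPoly.

(** * Divisibility by [l] and uniqueness of the invariants *)

Section Iwasawa.
Variables (l : nat) (l_pr : prime l).
Local Notation Zl := (padic_int l_pr).

Lemma dvd_ell0 : dvd_ell (0 : Zl).
Proof. by exists 0; rewrite mulr0. Qed.

Lemma dvd_ellD (x y : Zl) : dvd_ell x -> dvd_ell y -> dvd_ell (x + y).
Proof. by move=> [a ->] [b ->]; exists (a + b); rewrite mulrDr. Qed.

Lemma dvd_ellMr (x y : Zl) : dvd_ell x -> dvd_ell (x * y).
Proof. by move=> [a ->]; exists (a * y); rewrite mulrA. Qed.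

Lemma dvd_ell_sum (I : finType) (P : pred I) (F : I -> Zl) :
  (forall i, P i -> dvd_ell (F i)) -> dvd_ell (\sum_(i | P i) F i).
Proof. by move=> dF; elim/big_ind: _ => //; [apply: dvd_ell0 | apply: dvd_ellD]. Qed.

Lemma dvd_ell1F : ~ dvd_ell (1 : Zl).
Proof.
case=> y /(congr1 (fun x => residue x 1)).
rewrite residueM residue_nat expn1 modzz mul0r mod0z /=.
by rewrite modz_small // ltz_nat prime_gt1.
Qed.

(** The constant terms of [u] and its inverse multiply to [1]. *)
Lemma fps_unit_coef0 (u : fps Zl) : u \is a GRing.unit -> ~ dvd_ell (coefs u 0).
Proof.
move=> u_unit dvd_u0; apply: dvd_ell1F.
have <- : coefs u 0 * coefs u^-1 0 = 1.
  by have /(congr1 (fun f => coefs f 0)) := mulrV u_unit; rewrite /= big_ord1.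
exact: dvd_ellMr.
Qed.

Section DistinguishedTimesUnit.
Variables (g : {poly Zl}) (u : fps Zl).
Hypotheses (g_dist : distinguished g) (u_unit : u \is a GRing.unit).

Lemma distinguished_unit_coef_lt i :
  (i < (size g).-1)%N -> dvd_ell (coefs (fps_of_poly g * u) i).
Proof.
move=> lt_i; apply: dvd_ell_sum => j _; apply: dvd_ellMr.
by apply: g_dist.2; apply: leq_ltn_trans lt_i; rewrite -ltnS.
Qed.

(** Modulo [l] only the leading term of [g] survives in this coefficient, leaving the constant term
    of [u]. *)
Lemma distinguished_unit_coef_deg :
  ~ dvd_ell (coefs (fps_of_poly g * u) (size g).-1).
Proof.
rewrite /= big_ord_recr /= subnn -lead_coefE (monicP g_dist.1) mul1r => dvd_d.
apply: (fps_unit_coef0 u u_unit).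
set s := \sum_(i < _) _ in dvd_d.
have dvd_s : dvd_ell s.
  by apply: dvd_ell_sum => j _; apply/dvd_ellMr/g_dist.2.
have -> : coefs u 0 = (s + coefs u 0) + s * (-1) by ring.
by apply: dvd_ellD => //; apply: dvd_ellMr.
Qed.

End DistinguishedTimesUnit.

(** If [m' < m], cancelling [l^m'] would make every coefficient of [g' u'] divisible by [l],
    including the one at [deg g']. *)
Lemma weierstrass_mu_le (f : fps Zl) w w' :
  weierstrass_fact f w -> weierstrass_fact f w' -> (w.1.1 <= w'.1.1)%N.
Proof.
case: w w' => [[m g] u] [[m' g'] u'] [gd uu ->] [gd' uu' eq_f] /=.
rewrite leqNgt; apply/negP => lt_m.
apply: (distinguished_unit_coef_deg g' u' gd' uu').
set d := _.-1; exists ((l ^ (m - m').-1)%:R * coefs (fps_of_poly g * u) d).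
have /(congr1 (fun f => coefs f d)) := eq_f.
rewrite -!mulrA -!natrX !coefs_natrM => /esym eq_d.
have lm_gt0 : (0 < l ^ m')%N by rewrite expn_gt0 prime_gt0.
apply: (padic_natr_lreg lm_gt0); rewrite eq_d !mulrA -!natrM -mulnA -expnS -expnD.
by congr ((l ^ _)%:R * _); lia.
Qed.

(** With the common power of [l] cancelled, [g u] and [g' u'] agree. If [deg g' < deg g], their
    coefficient at [deg g'] would be both divisible and not divisible by [l]. *)
Lemma weierstrass_deg_le (f : fps Zl) w w' :
    weierstrass_fact f w -> weierstrass_fact f w' -> w.1.1 = w'.1.1 ->
  ((size w.1.2).-1 <= (size w'.1.2).-1)%N.
Proof.
case: w w' => [[m g] u] [[m' g'] u'] [gd uu ->] [gd' uu' eq_f] /= eq_m.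
rewrite leqNgt -{}eq_m in eq_f *; apply/negP => lt_d.
apply: (distinguished_unit_coef_deg g' u' gd' uu').
have /(congr1 (fun f => coefs f (size g').-1)) := eq_f.
rewrite -!mulrA -!natrX !coefs_natrM.
have lm_gt0 : (0 < l ^ m)%N by rewrite expn_gt0 prime_gt0.
move/(padic_natr_lreg lm_gt0) => <-.
exact: distinguished_unit_coef_lt.
Qed.

(** The existence of [w] rules out the dummy value, so the chosen triple is itself a factorization,
    and the two inequalities apply in both directions. *)
Lemma weierstrass_invariants (f : fps Zl) w : weierstrass_fact f w ->
  (weierstrass f).1.1 = w.1.1 /\
  (size (weierstrass f).1.2).-1 = (size w.1.2).-1.
Proof.
move=> fw; have fw' : weierstrass_fact f (weierstrass f).
  by apply: (@xgetPex _ _ [set w | weierstrass_fact f w]%classic); exists w.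
have eq_mu : (weierstrass f).1.1 = w.1.1.
  by apply/eqP; rewrite eqn_leq !(weierstrass_mu_le f).
by split=> //; apply/eqP; rewrite eqn_leq !(weierstrass_deg_le f).
Qed.

(** * Distinguished polynomials congruent to a power of [X] modulo [l] *)

Lemma size_XnDell n (s : {poly Zl}) : (size s <= n)%N ->
  size ('X^n + l%:R * s) = n.+1.
Proof.
move=> le_s; rewrite size_polyDl size_polyXn // ltnS.
exact: leq_trans (size_natrM_leq _ _ _) le_s.
Qed.

Lemma distinguished_XnDell n (s : {poly Zl}) : (size s <= n)%N ->
  distinguished ('X^n + l%:R * s).
Proof.
move=> le_s; have coefE i : ('X^n + l%:R * s)`_i = (i == n)%:R + l%:R * s`_i.
  by rewrite coefD coefXn mulr_natl coefMn mulr_natl.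
split=> [|i].
  rewrite monicE lead_coefE size_XnDell //= coefE eqxx.
  by rewrite nth_default // mulr0 addr0.
rewrite size_XnDell //= coefE => /ltn_eqF ->; rewrite add0r.
by exists s`_i.
Qed.

Lemma onepX_pow_ell n : exists2 r : {poly Zl}, (size r <= l ^ n)%N &
  (1 + 'X) ^+ (l ^ n) - 1 = 'X^(l ^ n) + l%:R * r.
Proof.
set q := (l ^ n)%N; have q_gt0 : (0 < q)%N by rewrite expn_gt0 prime_gt0.
(* The term [k = 0] of the binomial expansion cancels against [-1] and [k = q] gives [X^q]. All
   others are divisible by [l]. *)
exists (\poly_(k < q) (if k == 0%N then 0 else ('C(q, k) %/ l)%:R)).
  exact: size_poly.
apply/polyP=> k.
rewrite coefB coefD coefXn coef1 mulr_natl coefMn coef_poly.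
rewrite [1 + 'X]addrC coef_XD1_exp.
case: (ltngtP k q) => [lt_kq|lt_qk|->]; last 2 first.
- by rewrite bin_small // mul0rn addr0 eqn0Ngt (leq_ltn_trans _ lt_qk) // subrr.
- by rewrite binn mul0rn addr0 eqn0Ngt q_gt0 subr0.
case: (posnP k) => [->|k_gt0]; first by rewrite bin0 subrr mul0rn addr0.
rewrite subr0 add0r -mulrnA divnK // prime_dvd_bin_exp //.
by rewrite k_gt0.
Qed.

(** * The series [(1+T)^b] for l-adic exponents *)

Lemma padic_binomS (b : Zl) n :
  padic_binom (b + 1) n.+1 = padic_binom b n.+1 + padic_binom b n.
Proof.
(* Pascal's rule is checked after multiplying by [(n+1)!]. With [Q] the product of the [b - i] for
   [i < n], it reads [Q (b - n) + (n+1) Q = (b+1) Q]. *)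
apply/esym/padic_binom_unique; rewrite mulrDr padic_binomE.
rewrite factS natrM -[_ * _ * padic_binom b n]mulrA padic_binomE.
rewrite big_ord_recr big_ord_recl /= subr0.
under [in RHS]eq_bigr => i _.
  have -> : b + 1 - (lift ord0 i)%:R = b - i%:R.
    by rewrite lift0 -natr1; ring.
  over.
rewrite -natr1; ring.
Qed.

Lemma padic_binom0 (b : Zl) : padic_binom b 0 = 1.
Proof. by apply/esym/padic_binom_unique; rewrite big_ord0 mulr1. Qed.

Lemma onepT_pow0 : onepT_pow (0 : Zl) = 1.
Proof.
apply: fps_eqP => -[|n] /=; first by rewrite padic_binom0.
by apply/esym/padic_binom_unique; rewrite big_ord_recl subrr mul0r mulr0.
Qed.

(** Pascal's rule, coefficient by coefficient. Iterated from the exponents [0] and [-m], it yields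
    the powers of [1+T] and their inverses. *)
Lemma onepT_powS (b : Zl) :
  onepT_pow (b + 1) = fps_of_poly (1 + 'X) * onepT_pow b.
Proof.
apply: fps_eqP => -[|n] /=; rewrite big_ord_recl coefD coef1 coefX addr0 mul1r /=.
  by rewrite big_ord0 addr0 !padic_binom0.
rewrite big_ord_recl coefD coef1 coefX add0r mul1r big1 ?addr0 => [|i _].
  by rewrite padic_binomS subn1.
by rewrite coefD coef1 coefX addr0 mul0r.
Qed.

Lemma onepT_powDn (b : Zl) m :
  onepT_pow (b + m%:R) = fps_of_poly (1 + 'X) ^+ m * onepT_pow b.
Proof.
elim: m => [|m IHm]; first by rewrite addr0 mul1r.
by rewrite -natr1 addrA onepT_powS IHm mulrA -exprS.
Qed.

Lemma onepT_pow_nat m :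
  onepT_pow (m%:R : Zl) = fps_of_poly (1 + 'X) ^+ m.
Proof. by rewrite -[m%:R]add0r onepT_powDn onepT_pow0 mulr1. Qed.

Lemma onepT_powNn m :
  fps_of_poly (1 + 'X) ^+ m * onepT_pow (- m%:R : Zl) = 1.
Proof. by rewrite -onepT_powDn addNr onepT_pow0. Qed.

(** * The characteristic series for the chosen voltages *)

Lemma bouquet_series_row_mx (a b : nat) (x y : Zl) :
  bouquet_series (row_mx (const_mx x : 'rV_a) (const_mx y : 'rV_b)) =
    a%:R * (2 - onepT_pow x - onepT_pow (- x))
    + b%:R * (2 - onepT_pow y - onepT_pow (- y)).
Proof.
rewrite /bouquet_series big_split_ord /= !mulr_natl.
under eq_bigr do rewrite row_mxEl mxE; rewrite sumr_const card_ord.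
by under eq_bigr do rewrite row_mxEr mxE; rewrite sumr_const card_ord.
Qed.

Lemma bouquet_series_1_natE (a q : nat) : (0 < q)%N ->
  bouquet_series (row_mx (const_mx 1 : 'rV[Zl]_(l * a)) (const_mx q%:R : 'rV_a)) =
    a%:R * fps_of_poly (((1 + 'X) ^+ q - 1) ^+ 2
                        + l%:R * ('X ^+ 2 * (1 + 'X) ^+ q.-1))
         * - onepT_pow (- q%:R).
Proof.
(* Writing [X] as [(1+X) - 1] makes [1+X] the only variable, so that it can be generalized. *)
move=> q_gt0; have -> : 'X ^+ 2 = ((1 + 'X) - 1) ^+ 2 :> {poly Zl}.
  by rewrite addrC addKr.
rewrite bouquet_series_row_mx natrM onepT_pow_nat (onepT_pow_nat 1 : _ 1 = _).
have := onepT_powNn q; have := onepT_powNn 1; move: (1 + 'X) => Y.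
have -> : fps_of_poly ((Y ^+ q - 1) ^+ 2 + l%:R * ((Y - 1) ^+ 2 * Y ^+ q.-1)) =
    (fps_of_poly Y ^+ q - 1) ^+ 2
    + l%:R * ((fps_of_poly Y - 1) ^+ 2 * fps_of_poly Y ^+ q.-1).
  by rewrite rmorphD !rmorphM rmorph_nat !rmorphXn !rmorphB rmorphXn rmorph1.
have -> : fps_of_poly Y ^+ q = fps_of_poly Y * fps_of_poly Y ^+ q.-1.
  by rewrite -exprS prednK.
rewrite expr1.
move: (fps_of_poly Y) => A; move: (A ^+ q.-1) => D.
move: (onepT_pow (- 1%:R)) (onepT_pow (- q%:R)) => A' E AA' ADE.
(* Both [A'] and [D E] are inverse to [A]. Eliminating [A'] leaves an identity that follows from
   [A D E = 1] alone. *)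
have -> : A' = D * E by rewrite -[A']mulr1 -ADE; ring: AA'.
ring: ADE.
Qed.

Lemma weierstrass_poly n (q := (l ^ n)%N) : (1 < q)%N ->
  exists2 s : {poly Zl}, (size s <= q + q)%N &
    ((1 + 'X) ^+ q - 1) ^+ 2 + l%:R * ('X ^+ 2 * (1 + 'X) ^+ q.-1)
      = 'X^(q + q) + l%:R * s.
Proof.
move=> q_gt1; have [r size_r def_r] := onepX_pow_ell n.
rewrite -/q in size_r def_r; clearbody q.
(* The first two terms come from squaring [X^q + l r], the last from the loops with voltage [1]. *)
exists (2%:R * ('X^q * r) + l%:R * r ^+ 2 + 'X^2 * (1 + 'X) ^+ q.-1).
  exact: size_weierstrass_poly_tail.
by rewrite def_r exprD; ring.
Qed.

End Iwasawa.

Theorem lemma2p17 (n1 n2 l : nat) (hn2 : (1 <= n2)%N) (l_pr : prime l) :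
  exists alpha : 'rV[padic_int l_pr]_(l ^ n1.+1 + l ^ n1)%N,
    [/\ admissible alpha,
        mu_inv alpha = n1
      & lambda_inv alpha = 2 * (l ^ n2)%N%:Z - 1].
Proof.
have l_gt0 n : (0 < l ^ n)%N by rewrite expn_gt0 prime_gt0.
set q := (l ^ n2)%N.
(* This is where [n2 >= 1] enters. *)
have q_gt1 : (1 < q)%N by rewrite -(exp1n n2) ltn_exp2r ?prime_gt1.
pose alpha : 'rV[padic_int l_pr]_(l ^ n1.+1 + l ^ n1) :=
  row_mx (const_mx 1) (const_mx q%:R).
have [s size_s def_s] := weierstrass_poly l l_pr n2 q_gt1.
pose w : nat * {poly padic_int l_pr} * fps (padic_int l_pr) :=
  (n1, 'X^(q + q) + l%:R * s, - onepT_pow (- q%:R)).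
have fact_w : weierstrass_fact (bouquet_series alpha) w.
  split.
  - exact: distinguished_XnDell.
  (* The series with exponent [-q] is inverse to [(1+T)^q]. *)
  - rewrite unitrN; apply/unitrP; exists (fps_of_poly (1 + 'X) ^+ q).
    by split; rewrite 1?[onepT_pow _ * _]mulrC onepT_powNn.
  rewrite -natrX -def_s -bouquet_series_1_natE ?l_gt0 //.
  by rewrite /alpha expnS.
have [mu_w deg_w] := weierstrass_invariants l l_pr _ _ fact_w.
exists alpha; split.
(* The first loop has voltage [1], which [l] does not divide. *)
- move=> /(_ (lshift _ (Ordinal (l_gt0 n1.+1)))).
  by rewrite row_mxEl mxE; apply: dvd_ell1F.
- exact: mu_w.
- by rewrite /lambda_inv deg_w size_XnDell //= PoszD mulr_natl.
Qed.
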